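(* Let $p, k$ be positive integers, let $n$ be a non-negative integer, let $d$ be an odd integer and let $s$ be an even integer, and suppose that $$3^p(s+1) = 1 + 2^{k-1}\left(2\cdot 3^p\, n + d\right).$$ Then $$d \equiv -\left(2^{k-1}\right)^{-1} \pmod{3^p},$$ where $\left(2^{k-1}\right)^{-1}$ denotes the inverse of $2^{k-1}$ modulo $3^p$.
   Context: The inverse of $2^{k-1}$ is taken in the ring $\mathbb{Z}/3^p\mathbb{Z}$, where it exists because $2$ and $3$ are coprime. *)

(* Defs.v *)
From HB Require Import structures.
From mathcomp Require Import all_boot all_order all_algebra.
Set Implicit Arguments.
Unset Strict Implicit.
Unset Printing Implicit Defensive.
Import Order.TTheory GRing.Theory Num.Theory.
Local Open Scope ring_scope.

(* 'Z_m is the ring of integers mod m only when 1 < m. *)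
Lemma expn3_gt1 (p : nat) (hp : (0 < p)%N) : (1 < 3 ^ p)%N.
Proof. by rewrite -{1}(expn0 3) ltn_exp2l. Qed.

(* ^-1 is the identity on non-units, so invertibility is what makes
   (2 ^+ m)^-1 the actual inverse. *)
Lemma unit_exp2_Z3p (p m : nat) (hp : (0 < p)%N) :
  (2 ^+ m : 'Z_(3 ^ p)) \is a GRing.unit.
Proof. by rewrite unitrX // unitZpE ?expn3_gt1 // coprime_pexpl. Qed.

(* Main.v *)
Require Import Defs.
From HB Require Import structures.
From mathcomp Require Import all_boot all_order all_algebra.
Set Implicit Arguments.
Unset Strict Implicit.
Unset Printing Implicit Defensive.
Import Order.TTheory GRing.Theory Num.Theory.
Local Open Scope ring_scope.

(** Reduce the equation modulo $3^p$: every term carrying $3^p$ vanishes, leaving $0 = 1 + 2^{k-1}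
    d$. Since $2^{k-1}$ is a unit there, this determines $d$. *)

Theorem lemma2p1 (p k n : nat) (d s : int)
  (hp : (0 < p)%N) (hk : (0 < k)%N)
  (hd : ~~ (2 %| d)%Z) (hs : (2 %| s)%Z)
  (h : 3 ^+ p * (s + 1) = 1 + 2 ^+ k.-1 * (2 * 3 ^+ p * n%:Z + d)) :
  d%:~R = - (2 ^+ k.-1)^-1 :> 'Z_(3 ^ p).
Proof.
have z3 : (3 : 'Z_(3 ^ p)) ^+ p = 0 by rewrite -natrX pchar_Zp // expn3_gt1.
have u2 := unit_exp2_Z3p k.-1 hp.
have := congr1 (intr : int -> 'Z_(3 ^ p)) h.
rewrite !(rmorphD, rmorphM, rmorphXn) /= z3 mul0r mulr0 mul0r add0r => /esym/eqP.
rewrite addrC addr_eq0 => /eqP e.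
(* Units are cancellable, so it suffices to compare both sides multiplied by $2^{k-1}$: each becomes
   $-1$, the left by [e], the right by invertibility. *)
by apply: (mulrI u2); rewrite e mulrN divrr.
Qed.
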